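(* Let $(W,S)$ be an affine Coxeter system with spherical Weyl group $W_0$. Let $x,y\in W$ with $\ell(xy)=\ell(x)+\ell(y)$. Let $a\in W_0$ and $\varphi\in\mathrm{Dir}(W)$. Then $$\mathrm{Sh}_\varphi^a(xy)=\bigcup_{b\in W_0}\mathrm{Sh}_\varphi^b(x)\cdot \mathrm{Sh}_{b^{-1}\varphi}^{b^{-1}a}(y),$$ where for subsets $A,B\subseteq W$ one writes $A\cdot B=\{uv:u\in A,\ v\in B\}$.
   Context: Coxeter complex. $\Sigma=\Sigma(W,S)$ is the Coxeter complex; its alcoves (maximal simplices) are identified with the elements of $W$, and its panels (codimension-one faces) with the cosets $xW_{\{s\}}=\{x,xs\}$, $x\in W,\ s\in S$. The panel $xW_{\{s\}}$ has type $s$ and is contained exactly in the alcoves $x$ and $xs$. $W$ acts on $\Sigma$ by left multiplication. For a reflection $r\in R=\bigcup_{x}xSx^{-1}$, $H_r$ denotes its hyperplane (wall); the panel $xW_{\{s\}}$ lies in $H_{xsx^{-1}}$. $\ell$ is word length with respect to $S$. The alcove of the identity element is denoted $\mathbf 1$. Affine setting. The affine Coxeter group $W$ acts on a Euclidean space tiled by $\Sigma$; $W=T\rtimes W_0$ with $T$ the translation subgroup and $W_0$ (the spherical Weyl group) the stabilizer of a fixed special vertex $0$ of the alcove $\mathbf 1$. For $y\in W$, $\bar y\in W_0$ denotes its image under the natural projection $W\to W_0$ with kernel $T$. For $v$ in the $T$-orbit of $0$, the closures of the connected components of the complement of the union of all hyperplanes through $v$ are called Weyl chambers. A direction is a class of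 Weyl chambers modulo translation (equivalently a chamber of the boundary sphere $\partial\Sigma$); $\mathrm{Dir}(W)$ is the set of directions. $W$, and in particular $W_0$, acts on $\mathrm{Dir}(W)$ by acting on representatives ($T$ acts trivially). Orientation. For $\varphi\in\mathrm{Dir}(W)$ and a hyperplane $H$, the $\varphi$-positive side of $H$ is the half-space of $H$ that contains some Weyl chamber representing $\varphi$; the other one is the $\varphi$-negative side. Galleries. A gallery is a sequence $\gamma=(c_0,p_1,c_1,\dots,p_n,c_n)$ of alcoves $c_i$ and panels $p_i$ with $p_i$ contained in both $c_{i-1}$ and $c_i$ (and $c_{i-1}=c_i$ is allowed). Its type is the word formed by the types of $p_1,\dots,p_n$. It is $\varphi$-positively folded if for every $i$ with $c_{i-1}=c_i$ the alcove $c_i$ lies on the $\varphi$-positive side of the hyperplane containing $p_i$. Shadows. $\mathrm{Sh}_\varphi(x)$ is the set of all $z\in W$ such that there is a $\varphi$-positively folded gallery of type $w$ from $\mathbf 1$ to $z$, where $w$ is a reduced word for $x$ (the set does not depend on the choice of $w$). For $a\in W_0$, the partial shadow in local direction $a$ is $\mathrm{Sh}_\varphi^a(x)=\{z\in\mathrm{Sh}_\varphi(x):\bar z=a\}$. *)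

(* Defs.v *)
From HB Require Import structures.
From mathcomp Require Import all_boot all_order all_algebra.
From mathcomp Require Import all_classical all_reals all_analysis.
Import Order.TTheory GRing.Theory Num.Theory.
Import numFieldNormedType.Exports.

Set Implicit Arguments.
Unset Strict Implicit.
Unset Printing Implicit Defensive.

Local Open Scope classical_set_scope.
Local Open Scope ring_scope.
Local Open Scope group_scope.

Definition word_for (W : groupType) (S : set W) (w : seq W) (x : W) : Prop :=
  (forall s, s \in w -> S s) /\ \prod_(s <- w) s = x.

Definition reduced_word (W : groupType) (S : set W) (w : seq W) (x : W) : Prop :=
  word_for S w x /\ forall w', word_for S w' x -> (size w <= size w')%N.

(** Word length (the default value 0 is never used when [S] generates). *)
Definition length (W : groupType) (S : set W) (x : W) : nat :=
  xget 0%N [set k | exists2 w, reduced_word S w x & size w = k].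

(** [W] has the presentation with generators [S] and relations
    [(s t) ^ m(s,t) = 1], where [m(s,t)] is the order of [s t] (no relation if
    it is infinite); the relations are imposed for all [k] with [(s t)^k = 1],
    that is for all multiples of [m(s,t)].  As [S] generates, the extension
    [g] of [f] is unique. *)
Definition coxeter_system (W : groupType) (S : set W) : Prop :=
  [/\ forall s, S s -> s <> 1 /\ s * s = 1,
      forall x, exists w, word_for S w x
    & forall (G : groupType) (f : W -> G),
        (forall s t k, S s -> S t -> (s * t) ^+ k = 1 ->
           (f s * f t) ^+ k = 1) ->
        exists g : W -> G,
          {morph g : x y / x * y} /\ (forall s, S s -> g s = f s)].

Definition is_reflection (W : groupType) (S : set W) (r : W) : Prop :=
  exists x s, S s /\ r = x * s * x^-1.

Section Euclidean.
Context {R : realType} {n : nat}.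
Implicit Types (u v al : 'rV[R]_n) (H P : set 'rV[R]_n).

Definition dot u v : R := (\sum_(i < n) u ord0 i * v ord0 i)%R.

Definition affine_hyperplane al (c : R) : set 'rV[R]_n :=
  [set v | dot al v = c].

Definition orthogonal_reflection al (c : R) v : 'rV[R]_n :=
  (v - (2 * (dot al v - c) / dot al al) *: al)%R.

Definition translate v (D : set 'rV[R]_n) : set 'rV[R]_n :=
  [set (u + v)%R | u in D].

(** The closed half-spaces of [H]; replacing [(al, c)] by its opposite gives
    the other one. *)
Definition half_space H P : Prop :=
  exists al c, [/\ al <> 0%R, H = affine_hyperplane al c
                 & P = [set v | (c <= dot al v)%R]].

Definition complement (F : set (set 'rV[R]_n)) : set 'rV[R]_n :=
  ~` \bigcup_(H in F) H.

Definition component (F : set (set 'rV[R]_n)) (C : set 'rV[R]_n) : Prop :=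
  exists2 p, complement F p & C = connected_component (complement F) p.

End Euclidean.

Section Action.
Context {R : realType} {n : nat} {W : groupType}.
Variables (S : set W) (act : W -> 'rV[R]_n -> 'rV[R]_n).

Definition fixed_set (r : W) : set 'rV[R]_n := [set v | act r v = v].

Definition walls : set (set 'rV[R]_n) :=
  [set H | exists2 r, is_reflection S r & H = fixed_set r].

(** [H] supports a codimension-one face of [C]: some point of
    [H `&` closure C] lies on no wall other than [H]. *)
Definition wall_of (C H : set 'rV[R]_n) : Prop :=
  walls H /\ exists p, [/\ closure C p, H p
                         & forall H', walls H' -> H' p -> H' = H].

Definition special_point (o : 'rV[R]_n) : Prop :=
  forall H, walls H ->
    exists H' v, [/\ walls H', H' o & H = translate v H'].

Definition vertex_point (o : 'rV[R]_n) : Prop :=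
  [set v | forall H, walls H -> H o -> H v] = [set o].

End Action.

(** A Coxeter system [(W, S)] realised as a Euclidean reflection group with
    bounded alcoves.  The base alcove is recorded through its interior (a
    connected component of the complement of the walls), and the origin of the
    Euclidean space is the chosen special vertex. *)
Record affine_coxeter_system (R : realType) (n : nat) := AffineCoxeterSystem {
  cox_group :> groupType;
  gens : set cox_group;
  act : cox_group -> 'rV[R]_n -> 'rV[R]_n;
  base_alcove : set 'rV[R]_n;
  gens_coxeter : coxeter_system gens;
  act_one : forall v, act 1 v = v;
  act_mul : forall x y v, act (x * y) v = act x (act y v);
  act_faithful : forall x y, (forall v, act x v = act y v) -> x = y;
  act_gens : forall s, gens s ->
    exists al c, al <> 0%R /\
      forall v, act s v = orthogonal_reflection al c v;
  walls_locally_finite : forall K, compact K ->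
    finite_set [set H | walls gens act H /\ H `&` K !=set0];
  base_alcove_component : component (walls gens act) base_alcove;
  base_alcove_bounded : bounded_set base_alcove;
  gens_walls : forall r, is_reflection gens r ->
    (gens r <-> wall_of gens act base_alcove (fixed_set act r));
  origin_in_alcove : closure base_alcove 0%R;
  origin_vertex : vertex_point gens act 0%R;
  origin_special : special_point gens act 0%R
}.

Section Shadows.
Context {R : realType} {n : nat} {A : affine_coxeter_system R n}.
Implicit Types (x y z r s a : A) (phi : set (set 'rV[R]_n)).

Definition len x : nat := length (@gens _ _ A) x.

(** Open alcoves suffice: an open alcove lies in a closed half-space iff its
    closure does. *)
Definition alcove x : set 'rV[R]_n := [set act x v | v in base_alcove A].

Definition hyperplane r : set 'rV[R]_n := fixed_set (@act _ _ A) r.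

Definition is_translation x : Prop :=
  exists v, forall u, act x u = (u + v)%R.

(** The projection [W -> W0] with kernel [T]: the element of [W0] congruent to
    [x] modulo [T] (the default value 1 is never used as [W = T W0]). *)
Definition spherical_part x : A :=
  xget 1 [set a | act a 0%R = 0%R /\ is_translation (x * a^-1)].

Definition walls_through (v : 'rV[R]_n) : set (set 'rV[R]_n) :=
  [set H | walls (@gens _ _ A) (@act _ _ A) H /\ H v].

Definition weyl_chamber (D : set 'rV[R]_n) : Prop :=
  exists t : A, is_translation t /\
    exists2 C, component (walls_through (act t 0%R)) C & D = closure C.

(** A direction is encoded as the translation class itself, i.e. the set of all
    Weyl chambers representing it. *)
Definition is_direction phi : Prop :=
  exists2 D, weyl_chamber D
    & phi = [set D' | weyl_chamber D' /\ exists v, D' = translate v D].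

Definition dir_act x phi : set (set 'rV[R]_n) :=
  [set [set act x v | v in D] | D in phi].

Definition positive_side phi (H P : set 'rV[R]_n) : Prop :=
  half_space H P /\ exists2 D, phi D & D `<=` P.

Definition on_positive_side phi (H : set 'rV[R]_n) x : Prop :=
  exists2 P, positive_side phi H P & alcove x `<=` P.

(** A panel is a coset [x W_{s}], contained exactly in the alcoves that are its
    elements. *)
Definition panel_of_type (p : set A) s : Prop :=
  gens s /\ exists x, p = [set x; x * s].

Definition panel_hyperplane (p : set A) (H : set 'rV[R]_n) : Prop :=
  exists x s, [/\ gens s, p = [set x; x * s] & H = hyperplane (x * s * x^-1)].

(** The gallery [(c0, p1, c1, ..., pn, cn)] is given by [c0] and the sequence of
    the pairs [(pi, ci)]. *)
Fixpoint is_gallery (c : A) (g : seq (set A * A)) : Prop :=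
  if g is (p, d) :: g' then
    [/\ exists s, panel_of_type p s, p c, p d & is_gallery d g']
  else True.

Fixpoint gallery_type (g : seq (set A * A)) (w : seq A) : Prop :=
  match g, w with
  | [::], [::] => True
  | (p, _) :: g', s :: w' => panel_of_type p s /\ gallery_type g' w'
  | _, _ => False
  end.

Definition gallery_end (c : A) (g : seq (set A * A)) : A :=
  last c [seq step.2 | step <- g].

Fixpoint positively_folded phi (c : A) (g : seq (set A * A)) : Prop :=
  if g is (p, d) :: g' then
    (c = d -> forall H, panel_hyperplane p H -> on_positive_side phi H d)
    /\ positively_folded phi d g'
  else True.

(** The shadow does not depend on the reduced word, so the reduced word is
    quantified existentially. *)
Definition shadow phi x : set A :=
  [set z | exists w g, [/\ reduced_word (@gens _ _ A) w x,
      is_gallery 1 g, gallery_type g w, gallery_end 1 g = z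
    & positively_folded phi 1 g]].

Definition partial_shadow phi a x : set A :=
  [set z | shadow phi x z /\ spherical_part z = a].

End Shadows.

(** The spherical Weyl group: the stabiliser of the special vertex 0. *)
Definition W0 (R : realType) (n : nat) (A : affine_coxeter_system R n) : set A :=
  [set a | act a 0%R = 0%R].
Arguments W0 {R n} A.

Arguments weyl_chamber {R n} A D.
Arguments is_direction {R n} A phi.
Arguments walls_through {R n} A v.

Definition set_mul (W : groupType) (X Y : set W) : set W :=
  [set u * v | u in X & v in Y].

(* Main.v *)
(** The shadow may be computed with any reduced word, hence with the concatenation
    of reduced words [v] of [x] and [u] of [y]: cut a gallery of type [v ++ u]
    after [v], at an alcove [m], and move the second half by [m^-1]; as
    translations fix directions, [m^-1] turns [phi] into [b^-1 phi], where [b] is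
    the spherical part of [m].

    Independence of the reduced word: finitely many walls are involved, so there
    is an alcove [d] on the [phi]-negative side of all of them, and
    [phi]-positive folds are exactly the folds away from [d].  After multiplying
    by [d^-1], the ends of the galleries of type [w] starting at [e] are obtained
    by letting [w] act on the right on [e] by the operators
    [c |-> {c s} or {c s, c}].  These commute with the analogous operators on the
    left, so one may start at the identity and act on the left by a reduced word
    of [e] afterwards; starting at the identity, a reduced word [w] leads only to
    its product. *)

Require Import Defs.
From mathcomp Require Import all_boot all_order all_algebra.
From mathcomp Require Import all_classical all_reals all_analysis.
From mathcomp Require Import ring lra.
Import Order.TTheory GRing.Theory Num.Theory.
Import numFieldNormedType.Exports.

Set Implicit Arguments.
Unset Strict Implicit.
Unset Printing Implicit Defensive.

Local Open Scope group_scope.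
Local Open Scope classical_set_scope.
Local Open Scope ring_scope.

(** * Euclidean geometry *)

Section Dot.
Context {R : realType} {n : nat}.
Implicit Types (u v w al be : 'rV[R]_n) (c k : R).

Lemma dotC u v : dot u v = dot v u.
Proof. by apply: eq_bigr => i _; rewrite mulrC. Qed.

Lemma dotDl u v w : dot (u + v) w = dot u w + dot v w.
Proof. by rewrite /dot -big_split; apply: eq_bigr => i _; rewrite mxE mulrDl. Qed.

Lemma dotZl k u w : dot (k *: u) w = k * dot u w.
Proof. by rewrite /dot mulr_sumr; apply: eq_bigr => i _; rewrite mxE mulrA. Qed.

Lemma dotNl u w : dot (- u) w = - dot u w.
Proof. by rewrite -scaleN1r dotZl mulN1r. Qed.

Lemma dotDr u v w : dot u (v + w) = dot u v + dot u w.
Proof. by rewrite !(dotC u) dotDl. Qed.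

Lemma dotZr k u w : dot u (k *: w) = k * dot u w.
Proof. by rewrite !(dotC u) dotZl. Qed.

Lemma dotNr u w : dot u (- w) = - dot u w.
Proof. by rewrite !(dotC u) dotNl. Qed.

Lemma dot0l u : dot 0 u = 0.
Proof. by rewrite -(scale0r u) dotZl mul0r. Qed.

Lemma dot0r u : dot u 0 = 0.
Proof. by rewrite dotC dot0l. Qed.

Definition dotE := (dotDl, dotDr, dotNl, dotNr, dotZl, dotZr, dot0l, dot0r).

Lemma dot_ge0 u : 0 <= dot u u.
Proof. by apply: sumr_ge0 => i _; rewrite -expr2 sqr_ge0. Qed.

Lemma dot_eq0 u : dot u u = 0 -> u = 0.
Proof.
move=> /eqP; rewrite psumr_eq0 => [/allP h|i _]; last by rewrite -expr2 sqr_ge0.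
apply/rowP => i; rewrite mxE.
by have := h i (mem_index_enum _); rewrite -expr2 sqrf_eq0 => /eqP.
Qed.

Lemma dot_gt0 u : u <> 0 -> 0 < dot u u.
Proof. by move=> h; rewrite lt_neqAle dot_ge0 andbT eq_sym; apply/eqP => /dot_eq0. Qed.

Lemma dot_le u v : 2 * dot u v <= dot u u + dot v v.
Proof.
by have := dot_ge0 (u - v); rewrite !dotE (dotC v u) => h; lra.
Qed.

Lemma dot_sqD_le u v : dot (u + v) (u + v) <= 2 * dot u u + 2 * dot v v.
Proof. by have := dot_le u v; rewrite !dotE (dotC v u) => h; lra. Qed.

Lemma hyperplane_point al c : al <> 0 -> dot al ((c / dot al al) *: al) = c.
Proof. by move=> /dot_gt0 h; rewrite dotZr divfK // gt_eqF. Qed.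

(** The component [w] of [be] orthogonal to [al] is a direction of the smaller hyperplane, hence
    also orthogonal to [be]. So [w] is orthogonal to itself and vanishes. *)
Lemma hyperplane_subset_eq al c be k : al <> 0 -> be <> 0 ->
  affine_hyperplane al c `<=` affine_hyperplane be k ->
  exists l, [/\ l != 0, be = l *: al & k = l * c].
Proof.
move=> al0 be0 sub.
set x0 := (c / dot al al) *: al.
have x0P : dot be x0 = k by apply: sub; apply: hyperplane_point.
have alP := dot_gt0 al0.
set l := dot al be / dot al al.
have [w wE] : exists w, w = be - l *: al by exists (be - l *: al).
have alw : dot al w = 0.
  by rewrite wE !dotE /l divfK ?subrr // gt_eqF.
have bew : dot be w = 0.
  have : dot be (x0 + w) = k.
    by apply: sub; rewrite /affine_hyperplane /= dotDr alw addr0 hyperplane_point.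
  by rewrite dotDr x0P => /eqP; rewrite -subr_eq0 addrAC subrr add0r => /eqP.
have w0 : w = 0.
  by apply: dot_eq0; rewrite {1}wE !dotE bew alw mulr0 subr0.
have beE : be = l *: al by apply/eqP; rewrite -subr_eq0 -wE w0.
exists l; split => //.
  by apply/eqP => l0; apply: be0; rewrite beE l0 scale0r.
by rewrite -x0P beE dotZl hyperplane_point.
Qed.

Lemma fixed_orthogonal_reflection al c : al <> 0 ->
  [set v | orthogonal_reflection al c v = v] = affine_hyperplane al c.
Proof.
move=> al0; have aP := dot_gt0 al0; apply/seteqP; split => v /=.
  rewrite /orthogonal_reflection /affine_hyperplane /=.
  move=> /eqP; rewrite -subr_eq0 addrAC subrr add0r oppr_eq0 scaler_eq0.
  case/orP => [|/eqP //]; rewrite mulf_eq0 invr_eq0 (gt_eqF aP) orbF mulf_eq0 pnatr_eq0 /=.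
  by rewrite subr_eq0 => /eqP.
by rewrite /orthogonal_reflection => ->; rewrite subrr mulr0 mul0r scale0r subr0.
Qed.

Lemma orthogonal_reflectionZ l al c : l != 0 -> al <> 0 ->
  orthogonal_reflection (l *: al) (l * c) =1 orthogonal_reflection al c.
Proof.
move=> l0 al0 v; have /gt_eqF/negbT aP := dot_gt0 al0.
rewrite /orthogonal_reflection scalerA; congr (v - _ *: al); rewrite !dotE.
by field; rewrite aP l0.
Qed.

(** Reflecting [w] changes its squared distance to [v] by a positive multiple of the product of the
    signed heights of [v] and [w] over the hyperplane. This expresses sides of walls through
    distances alone. *)
Lemma reflection_side al c v w : al <> 0 ->
  let r := orthogonal_reflection al c in
  dot (v - r w) (v - r w) - dot (v - w) (v - w)
    = 4 * ((dot al v - c) * (dot al w - c)) / dot al al.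
Proof.
move=> al0 /=; have /gt_eqF/negbT aP := dot_gt0 al0.
rewrite /orthogonal_reflection !dotE (dotC v al) (dotC w al) (dotC w v); by field.
Qed.

End Dot.

(** * The reflection group *)

Section Affine.
Context {R : realType} {n : nat} {A : affine_coxeter_system R n}.
Implicit Types (x y z r s t : A) (v w al : 'rV[R]_n) (c k : R).

Notation gens := (@gens _ _ A).
Notation act := (@act _ _ A).
Notation reflection := (is_reflection gens).

Lemma gens_ind (P : A -> Prop) :
  P 1%g -> (forall s x, gens s -> P x -> P (s * x)%g) -> forall x, P x.
Proof.
move=> P1 PM x; have [_ /(_ x) [w [ws <-]] _] := gens_coxeter A.
elim: w ws => [|s w IH] ws; first by rewrite big_nil.
rewrite big_cons; apply: PM; first by apply: ws; rewrite mem_head.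
by apply: IH => u uw; apply: ws; rewrite in_cons uw orbT.
Qed.

Lemma gens_neq1 s : gens s -> s <> 1%g.
Proof. by have [h _ _] := gens_coxeter A => /h []. Qed.

Lemma gens_sq s : gens s -> (s * s = 1)%g.
Proof. by have [h _ _] := gens_coxeter A => /h []. Qed.

Lemma gens_inv s : gens s -> (s^-1 = s)%g.
Proof. by move=> /gens_sq h; rewrite -[RHS](mulKg s) h mulg1. Qed.

Lemma reflection_gens s : gens s -> reflection s.
Proof. by move=> h; exists 1%g, s; rewrite mul1g invg1 mulg1. Qed.

Lemma reflectionJ x r : reflection r -> reflection (x * r * x^-1)%g.
Proof. by case=> y [s [hs ->]]; exists (x * y)%g, s; rewrite invgM !mulgA. Qed.

Lemma reflection_sq r : reflection r -> (r * r = 1)%g.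
Proof. by case=> y [s [hs ->]]; rewrite !mulgA mulgVK -(mulgA y) gens_sq // mulg1 mulgV. Qed.

Lemma actK x : cancel (act x) (act x^-1%g).
Proof. by move=> v; rewrite -act_mul mulVg act_one. Qed.

Lemma actKV x : cancel (act x^-1%g) (act x).
Proof. by move=> v; rewrite -act_mul mulgV act_one. Qed.

Definition lin x v := act x v - act x 0.

Lemma act_lin x v : act x v = act x 0 + lin x v.
Proof. by rewrite addrC subrK. Qed.

Lemma lin_gens s : gens s -> exists al, al <> 0 /\
  forall v, lin s v = v - (2 * dot al v / dot al al) *: al.
Proof.
move=> /act_gens [al [c [al0 h]]]; exists al; split=> // v.
apply/rowP => i; rewrite /lin !h /orthogonal_reflection dot0r !mxE.
by have /gt_eqF/negbT := dot_gt0 al0 => aP; field.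
Qed.

(** Only generators are assumed to act by affine isometries, so linearity and orthogonality of the
    linear part are obtained by induction on words. Linearity of [lin s] is what makes [lin]
    multiplicative in the inductive step. *)
Lemma linP_dot x : (forall k v w, lin x (k *: v + w) = k *: lin x v + lin x w)
  /\ forall v w, dot (lin x v) (lin x w) = dot v w.
Proof.
elim/gens_ind: x => [|s x hs [IH IHd]].
  by rewrite /lin; split=> *; rewrite !act_one !subr0.
have [al [/dot_gt0/gt_eqF/negbT aP h]] := lin_gens hs.
have sl k v w : lin s (k *: v + w) = k *: lin s v + lin s w.
  by apply/rowP => i; rewrite !h !dotE !mxE; field.
have e v : lin (s * x) v = lin s (lin x v).
  rewrite [LHS]/lin !act_mul (act_lin s (act x v)) (act_lin s (act x 0)).
  rewrite opprD addrACA subrr add0r -scaleN1r addrC -sl scaleN1r addrC.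
  by [].
split=> [k v w|v w]; first by rewrite !e IH sl.
rewrite !e -[RHS]IHd !h; move: (lin x v) (lin x w) => v' w'.
by rewrite !dotE (dotC v' al); field.
Qed.

Lemma linP x k v w : lin x (k *: v + w) = k *: lin x v + lin x w.
Proof. by have [] := linP_dot x. Qed.

Lemma dot_lin x v w : dot (lin x v) (lin x w) = dot v w.
Proof. by have [] := linP_dot x. Qed.

Lemma lin0 x : lin x 0 = 0.
Proof. by rewrite /lin subrr. Qed.

Lemma linD x v w : lin x (v + w) = lin x v + lin x w.
Proof. by rewrite -{1}(scale1r v) linP scale1r. Qed.

Lemma linZ x k v : lin x (k *: v) = k *: lin x v.
Proof. by rewrite -(addr0 (k *: v)) linP lin0 addr0. Qed.

Lemma linB x v w : lin x (v - w) = lin x v - lin x w.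
Proof. by rewrite linD -scaleN1r linZ scaleN1r. Qed.

Lemma actB x v w : act x v - act x w = lin x (v - w).
Proof. by rewrite linB /lin opprB addrA subrK. Qed.

Lemma actD x v w : act x (v + w) = act x v + lin x w.
Proof. by rewrite act_lin linD addrA -act_lin. Qed.

Lemma act_isometry x v w :
  dot (act x v - act x w) (act x v - act x w) = dot (v - w) (v - w).
Proof. by rewrite actB dot_lin. Qed.

Lemma linM x y v : lin (x * y) v = lin x (lin y v).
Proof. by rewrite {1}/lin !act_mul actB. Qed.

Lemma linK x : cancel (lin x) (lin x^-1%g).
Proof. by move=> v; rewrite -linM mulVg /lin !act_one subr0. Qed.

Lemma linKV x : cancel (lin x^-1%g) (lin x).
Proof. by move=> v; rewrite -linM mulgV /lin !act_one subr0. Qed.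

Lemma lin_neq0 x v : v <> 0 -> lin x v <> 0.
Proof. by move=> v0 h; apply: v0; rewrite -(linK x v) h lin0. Qed.

Lemma dot_act x al v : dot (lin x al) (act x v) = dot al v + dot (lin x al) (act x 0).
Proof. by rewrite act_lin dotDr dot_lin addrC. Qed.

(** The pair [(al, c)] is determined only up to a common nonzero factor, whose sign orients the
    wall. *)
Definition reflection_data r al c :=
  al <> 0 /\ act r =1 orthogonal_reflection al c.

Lemma reflection_dataJ x r al c : reflection_data r al c ->
  reflection_data (x * r * x^-1) (lin x al) (c + dot (lin x al) (act x 0)).
Proof.
case=> al0 h; split; first exact: lin_neq0.
move=> v; rewrite !act_mul h /orthogonal_reflection actD actKV -scaleNr linZ scaleNr.
have -> : dot (lin x al) v = dot al (act x^-1%g v) + dot (lin x al) (act x 0).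
  by rewrite -dot_act actKV.
by rewrite dot_lin opprD addrACA subrr addr0.
Qed.

Lemma reflectionP r : reflection r -> exists al c, reflection_data r al c.
Proof.
case=> x [s [hs ->]]; have [al [c h]] := act_gens hs.
by exists (lin x al), (c + dot (lin x al) (act x 0)); apply: reflection_dataJ.
Qed.

Lemma hyperplaneE r al c : reflection_data r al c ->
  hyperplane r = affine_hyperplane al c.
Proof.
case=> al0 h; rewrite -(fixed_orthogonal_reflection _ al0).
by apply/seteqP; split=> v; rewrite /hyperplane /fixed_set /= h.
Qed.

(** Nested hyperplanes have proportional equations, hence the same orthogonal reflection, and the
    action is faithful. *)
Lemma hyperplane_inj r r' : reflection r -> reflection r' ->
  hyperplane r `<=` hyperplane r' -> r = r'.
Proof.
move=> /reflectionP[al [c h]] /reflectionP[be [k h']].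
rewrite (hyperplaneE h) (hyperplaneE h').
have [al0 e] := h; have [be0 e'] := h'.
move=> /hyperplane_subset_eq -/(_ al0 be0) [l [l0 E1 E2]].
by apply: (@act_faithful _ _ A) => v; rewrite e e' E1 E2 orthogonal_reflectionZ.
Qed.

Lemma hyperplaneJ x r v : hyperplane (x * r * x^-1) (act x v) <-> hyperplane r v.
Proof.
rewrite /hyperplane /fixed_set /= !act_mul actK; split=> [/(can_inj (actK x))//|->//].
Qed.

End Affine.

(** * Topology of Euclidean space: half-spaces, segments and balls *)

Section Topology.
Context {R : realType} {n : nat}.
Implicit Types (u v w al : 'rV[R]_n) (c k : R) (C : set 'rV[R]_n).

Lemma dot_continuous al : continuous (dot al).
Proof.
apply: (continuous_big add_continuous) => i _ v.
apply: (@continuous_comp _ _ _ (fun u : 'rV_n => u ord0 i)).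
  exact: coord_continuous.
exact: mulrl_continuous.
Qed.

Lemma closed_half_space al c : closed [set v | c <= dot al v].
Proof.
have := @closed_comp _ _ (dot al) `[c, +oo[%classic.
rewrite (_ : _ @^-1` _ = [set v | c <= dot al v]); last first.
  by apply/seteqP; split => v /=; rewrite in_itv /= andbT.
by apply=> [v _|]; [exact: dot_continuous | exact: interval_closed].
Qed.

Lemma connected_dot_side C al c : connected C -> (forall v, C v -> dot al v <> c) ->
  forall v w, C v -> C w -> c < dot al v -> c < dot al w.
Proof.
move=> cC nC v w Cv Cw cv.
have /connected_intervalP itv : connected (dot al @` C).
  by apply: connected_continuous_connected => //; apply/continuous_subspaceT/dot_continuous.
rewrite ltNge; apply/negP => wc.
have [z Cz /nC] : (dot al @` C) c; last by [].
by apply: (itv (dot al w) (dot al v)); [exists w | exists v | rewrite wc ltW].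
Qed.

Lemma affine_path_connected v w (a b : R) :
  connected ((fun k => v + k *: w) @` `[a, b]).
Proof.
apply: connected_continuous_connected; first exact: segment_connected.
apply: continuous_subspaceT => k.
apply: cvgD; [exact: cvg_cst | exact: scalel_continuous].
Qed.

Lemma bounded_set_dot C : bounded_set C -> exists M, forall v, C v -> dot v v <= M.
Proof.
case=> M [_ h]; exists (\sum_(i < n) (M + 1) ^+ 2) => v Cv; apply: ler_sum => i _.
have hv : `|v| <= M + 1 by apply: h => //; rewrite ltrDl.
have : `|v ord0 i| <= M + 1.
  apply: le_trans hv; rewrite [leRHS]/Num.norm /= mx_normrE.
  by apply/bigmax_geP; right; exists (ord0, i).
by rewrite -expr2 -real_normK ?num_real // => h'; rewrite ler_sqr ?nnegrE // (le_trans _ h').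
Qed.

Lemma dot_bounded_set M : bounded_set [set v : 'rV[R]_n | dot v v <= M].
Proof.
exists (1 + M); split; first exact: num_real.
move=> K hK v /= hv; rewrite [leLHS]/Num.norm /= mx_normrE; apply: bigmax_le => /= [|i _].
  by apply/ltW/lt_trans/hK; have := dot_ge0 v; lra.
have h : v i.1 i.2 ^+ 2 <= dot v v.
  rewrite /dot (bigD1 i.2) //= (ord1 i.1) -expr2 lerDl; apply: sumr_ge0 => j _.
  by rewrite -expr2 sqr_ge0.
have := sqr_ge0 (`|v i.1 i.2| - 1); rewrite -real_normK ?num_real // in h.
have := normr_ge0 (v i.1 i.2); nra.
Qed.

(** The ball is written as an intersection of closed half-spaces, with equality attained at
    [al = v - w]. Its convexity and closedness both follow from this. *)
Lemma ballE w M : [set v : 'rV[R]_n | dot (v - w) (v - w) <= M] =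
  [set v | forall al, 2 * dot al (v - w) <= M + dot al al].
Proof.
apply/seteqP; split=> v /= h => [al|].
  by have := dot_le al (v - w); lra.
by have := h (v - w); lra.
Qed.

Lemma ball_convex w M (u v : 'rV[R]_n) k : 0 <= k <= 1 ->
  dot (u - w) (u - w) <= M -> dot (v - w) (v - w) <= M ->
  dot (u + k *: (v - u) - w) (u + k *: (v - u) - w) <= M.
Proof.
move=> k01 hu hv; have := ballE w M; move=> /seteqP[s1 s2]; apply: s2 => al /=.
have := s1 _ hu al; have := s1 _ hv al; rewrite !dotE => h1 h2; nra.
Qed.

Lemma ball_compact w M : compact [set v : 'rV[R]_n | dot (v - w) (v - w) <= M].
Proof.
apply: bounded_closed_compact.
  have [N [Nr hN]] := dot_bounded_set (2 * M + 2 * dot w w).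
  exists N; split=> // K /hN hK v /= hv; apply: hK => /=.
  by have := dot_sqD_le (v - w) w; rewrite subrK; lra.
rewrite ballE (_ : mkset _ = \bigcap_(al in setT)
    [set v | - M - dot al al - 2 * dot al w <= dot (- (2 *: al)) v]).
  by apply: closed_bigI => al _; exact: closed_half_space.
apply/seteqP; split=> v /= h al; first by move=> _ /=; move: (h al); rewrite !dotE; lra.
by move: (h al I); rewrite /= !dotE; lra.
Qed.

End Topology.

(** * Inversions *)

Section Inversions.
Context {R : realType} {n : nat} {A : affine_coxeter_system R n}.
Implicit Types (x y z r s t : A) (v w al : 'rV[R]_n) (c k : R).

Notation gens := (@gens _ _ A).
Notation act := (@act _ _ A).
Notation reflection := (is_reflection gens).

Lemma reflectionP_pos r v : reflection r -> ~ hyperplane r v ->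
  exists al c, reflection_data r al c /\ c < dot al v.
Proof.
move=> /reflectionP[al [c h]]; rewrite (hyperplaneE h) /affine_hyperplane /= => vn.
have [lt|lt|e] := ltgtP c (dot al v); [by exists al, c| |by case: vn].
exists (- al), (- c); split; last by rewrite dotNl ltrN2.
have [al0 e] := h; split; first by move/eqP; rewrite oppr_eq0 => /eqP.
move=> w; rewrite e -(scaleN1r al) -(mulN1r c) orthogonal_reflectionZ //.
Qed.

(* The sign of [side r v w] tells whether [v] and [w] lie on the same side of
   the hyperplane of [r]; this expression is visibly invariant under isometries. *)
Definition side r v w : R :=
  dot (v - act r w) (v - act r w) - dot (v - w) (v - w).

Lemma sideE r al c v w : reflection_data r al c ->
  side r v w = 4 * ((dot al v - c) * (dot al w - c)) / dot al al.
Proof. by case=> al0 h; rewrite /side h reflection_side. Qed.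

Lemma side_lt0 r al c v w : reflection_data r al c ->
  (side r v w < 0) = ((dot al v - c) * (dot al w - c) < 0).
Proof.
move=> h; rewrite (sideE _ _ h); have [/dot_gt0 al0 _] := h.
by rewrite pmulr_llt0 ?invr_gt0 // pmulr_rlt0.
Qed.

Lemma sideJ x r v w : side (x * r * x^-1) (act x v) (act x w) = side r v w.
Proof. by rewrite /side !act_mul actK !act_isometry. Qed.

Lemma sideJV x r v w : side (x^-1 * r * x) v w = side r (act x v) (act x w).
Proof. by rewrite -(sideJ x) !mulgA mulgV mul1g mulgK. Qed.

Definition base_point : 'rV[R]_n := xget 0 (base_alcove A).
Notation p0 := base_point.

Lemma base_pointP : base_alcove A p0.
Proof.
have [p pC E] := base_alcove_component A; apply: xgetI.
by rewrite E; apply: connected_component_refl pC.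
Qed.

Lemma base_alcove_connected : connected (base_alcove A).
Proof. by have [p _ ->] := base_alcove_component A; exact: component_connected. Qed.

Lemma base_alcove_off x r v : reflection r -> base_alcove A v ->
  ~ hyperplane r (act x v).
Proof.
move=> hr Cv; have [p _ E] := base_alcove_component A.
rewrite E in Cv; have := connected_component_sub Cv => nC.
move=> h; apply: nC; exists (hyperplane (x^-1 * r * x^-1^-1)%g).
  by exists (x^-1 * r * x^-1^-1)%g => //; exact: reflectionJ.
by have := proj2 (hyperplaneJ x^-1%g r (act x v)) h; rewrite actK.
Qed.

Lemma base_point_off x r al c : reflection r -> reflection_data r al c ->
  dot al (act x p0) - c != 0.
Proof.
move=> hr h; apply/eqP => /eqP; rewrite subr_eq0 => /eqP e.
by apply: (@base_alcove_off x r p0 hr base_pointP); rewrite (hyperplaneE h).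
Qed.

Lemma base_alcove_side r al c v : reflection r -> reflection_data r al c ->
  c < dot al p0 -> base_alcove A v -> c < dot al v.
Proof.
move=> hr h cp Cv.
apply: (@connected_dot_side _ _ _ al c base_alcove_connected) base_pointP Cv cp.
move=> w Cw e; apply: (@base_alcove_off 1%g r w hr Cw).
by rewrite act_one (hyperplaneE h).
Qed.

(** The base alcove lies in a single closed half-space of each wall, so its closure does too. The
    inequality is weak because [v] may lie on the wall. *)
Lemma closure_base_alcove_side r v : reflection r -> closure (base_alcove A) v ->
  0 <= side r p0 v.
Proof.
move=> hr Cv.
have p0n : ~ hyperplane r p0.
  by have := @base_alcove_off 1%g r p0 hr base_pointP; rewrite act_one.
have [al [c [h cp]]] := reflectionP_pos hr p0n.
have [/dot_gt0 al0 _] := h.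
rewrite (sideE _ _ h) divr_ge0 ?(ltW al0) // mulr_ge0 // mulr_ge0 ?subr_ge0 ?(ltW cp) //.
have : closure [set w | c <= dot al w] v.
  by apply: closureS Cv => w /(base_alcove_side hr h cp)/ltW.
by move=> /closed_half_space.
Qed.

(** The wall of [r] separates the alcove [x] from the base alcove. *)
Definition inversion x r := side r p0 (act x p0) < 0.

Lemma inversion1 r : reflection r -> inversion 1 r = false.
Proof.
move=> /reflectionP[al [c h]]; rewrite /inversion act_one (side_lt0 _ _ h).
by rewrite -expr2 ltNge sqr_ge0.
Qed.

(** The cocycle rule: pass from the alcove 1 to [x], then to [x * y], and count crossings of the
    wall modulo 2. The second crossing is transported back by [x^-1]. *)
Lemma inversionM x y r : reflection r ->
  inversion (x * y) r = inversion x r (+) inversion y (x^-1 * r * x).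
Proof.
move=> hr; have [al [c h]] := reflectionP hr.
rewrite /inversion sideJV act_mul !(side_lt0 _ _ h).
have := base_point_off x hr h; have := base_point_off (x * y)%g hr h.
have := base_point_off 1%g hr h; rewrite act_one act_mul.
move: (_ - _) (_ - _) (_ - _) => a d b a0 d0 b0.
have sgn (e f : R) : e != 0 -> f != 0 -> (e * f < 0) = ((e < 0) (+) (f < 0)).
  move=> e0 f0; have [eN|eP|/eqP] := ltgtP e 0; last by rewrite (negbTE e0).
    by rewrite nmulr_rlt0 // ltNge le_eqVlt (negbTE f0).
  by rewrite pmulr_rlt0.
by rewrite !sgn //; do 3! case: (_ < 0).
Qed.

(** The alcoves 1 and [s] share a point lying on the wall of [s] and on no other wall. A wall
    separating the two alcoves must contain that point. *)
Lemma inversion_gens s r : gens s -> reflection r -> inversion s r = (r == s).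
Proof.
move=> hs hr; apply/idP/eqP => [h|->]; last first.
  rewrite /inversion /side -act_mul gens_sq // act_one subrr dot0l sub0r oppr_lt0.
  apply: dot_gt0 => /eqP; rewrite subr_eq0 => /eqP e.
  apply: (@base_alcove_off 1%g s p0 _ base_pointP); first exact: reflection_gens.
  by rewrite act_one.
have hs' := reflection_gens hs.
have [_ [p [Cp Hp uniqp]]] := proj1 (gens_walls hs') hs.
have s1 := closure_base_alcove_side hr Cp.
have s2 := closure_base_alcove_side (reflectionJ s^-1%g hr) Cp.
rewrite invgK sideJV Hp in s2.
have [al [c hd]] := reflectionP hr.
(* The heights of [p0] and [s p0] over the wall of [r] have opposite signs, and that of [p] is
   weakly compatible with both, hence zero. *)
have rp : hyperplane r p.
  move: h; rewrite /inversion (side_lt0 _ _ hd).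
  rewrite leNgt (side_lt0 _ _ hd) -leNgt in s1.
  rewrite leNgt (side_lt0 _ _ hd) -leNgt in s2.
  rewrite (hyperplaneE hd) /affine_hyperplane /= => {}h.
  apply/eqP; rewrite -subr_eq0; apply/eqP.
  move: (_ - _) (_ - _) (_ - _) s1 s2 h => b d a.
  have [aN|aP|->] := ltgtP a 0; last by rewrite !mul0r ltxx.
    rewrite nmulr_rge0 // nmulr_rlt0 // => d0 + bP; rewrite pmulr_rge0 // => d1.
    by apply/eqP; rewrite eq_le d0.
  rewrite pmulr_rge0 // pmulr_rlt0 // => d0 + bN; rewrite nmulr_rge0 // => d1.
  by apply/eqP; rewrite eq_le d0 d1.
by apply: hyperplane_inj => // v; rewrite (uniqp (hyperplane r)) //; exists r.
Qed.

Lemma inversion_gensM s x r : gens s -> reflection r ->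
  inversion (s * x) r = (r == s) (+) inversion x (s * r * s).
Proof. by move=> hs hr; rewrite inversionM // inversion_gens // gens_inv. Qed.

End Inversions.

(** * Galleries folded away from an alcove *)

Section Folding.
Context {R : realType} {n : nat} {A : affine_coxeter_system R n}.
Implicit Types (x y z r s t c : A) (w v : seq A).

Notation gens := (@gens _ _ A).
Notation reflection := (is_reflection gens).
Local Open Scope group_scope.

(** * Words, inversions and the exchange condition *)

Definition gens_word w := forall s, s \in w -> gens s.
Definition word_prod w : A := \prod_(s <- w) s.
Definition reduced w := gens_word w /\
  forall v, gens_word v -> word_prod v = word_prod w -> (size w <= size v)%N.

Lemma word_prod_nil : word_prod [::] = 1.
Proof. exact: big_nil. Qed.

Lemma word_prod_cons s w : word_prod (s :: w) = s * word_prod w.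
Proof. exact: big_cons. Qed.

Lemma word_prod_cat v w : word_prod (v ++ w) = word_prod v * word_prod w.
Proof. exact: big_cat. Qed.

Lemma gens_word_cons s w : gens_word (s :: w) <-> gens s /\ gens_word w.
Proof.
split=> [h|[hs h] u]; last by rewrite in_cons => /orP[/eqP->|/h].
by split=> [|u uw]; apply: h; rewrite in_cons ?eqxx // uw orbT.
Qed.

Lemma gens_word_cat v w : gens_word (v ++ w) <-> gens_word v /\ gens_word w.
Proof.
split=> [h|[hv hw] u]; last by rewrite mem_cat => /orP[/hv|/hw].
by split=> u uw; apply: h; rewrite mem_cat uw ?orbT.
Qed.

Lemma reduced_wordE w x :
  reduced_word gens w x <-> reduced w /\ word_prod w = x.
Proof.
split=> [[[h1 h2] h3]|[[h1 h2] h3]]; last first.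
  by split=> // v [hv hv']; apply: h2 => //; rewrite h3.
by split=> //; split=> // v hv e; apply: h3; split=> //; rewrite -h2.
Qed.

Lemma reduced_exists x : exists2 w, reduced w & word_prod w = x.
Proof.
have [_ /(_ x) [w0 h0] _] := gens_coxeter A.
have ex : exists k, `[< exists2 w, word_for gens w x & size w = k >].
  by exists (size w0); apply/asboolP; exists w0.
case: (ex_minnP ex) => k /asboolP[w [hw e] sw] mink; exists w => //.
split=> // v hv hve; rewrite sw; apply: mink; apply/asboolP; exists v => //.
by split=> //; rewrite -e.
Qed.

Lemma reduced_catr v w : reduced (v ++ w) -> reduced w.
Proof.
move=> [/gens_word_cat[hv hw] h]; split=> // u hu e.
have := h (v ++ u); rewrite !word_prod_cat e !size_cat leq_add2l; apply=> //.
exact/gens_word_cat.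
Qed.

Lemma reflection_gensJ s r : gens s -> reflection r -> reflection (s * r * s).
Proof. by move=> hs; rewrite -{2}(gens_inv hs); exact: reflectionJ. Qed.

(** A wall separating 1 from the end of the gallery without folds of type [w] is crossed at some
    letter [s] of it, the one after the prefix [w1]. *)
Lemma inversion_word w r : gens_word w -> reflection r ->
  inversion (word_prod w) r ->
  exists w1 s w2, w = w1 ++ s :: w2 /\ r = word_prod w1 * s * (word_prod w1)^-1.
Proof.
elim: w r => [|s w IH] r; first by rewrite word_prod_nil => _ /inversion1->.
move=> /gens_word_cons[hs hw] hr; rewrite word_prod_cons inversion_gensM //.
have [->|_ /=] := eqVneq r s; first by exists [::], s, w; rewrite word_prod_nil mul1g invg1 mulg1.
move=> /(IH _ hw (reflection_gensJ hs hr)) [w1 [t [w2 [-> e]]]].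
exists (s :: w1), t, w2; split=> //; rewrite word_prod_cons invgM (gens_inv hs).
have -> : r = s * (s * r * s) * s by rewrite !mulgA gens_sq // mul1g -(mulgA r) gens_sq // mulg1.
by rewrite e !mulgA.
Qed.

(** The strong exchange condition: [v] is [w] with the letter deleted at which the wall of [r] is
    crossed. *)
Lemma exchange w r : gens_word w -> reflection r -> inversion (word_prod w) r ->
  exists v, [/\ gens_word v, size w = (size v).+1 & word_prod v = r * word_prod w].
Proof.
move=> hw hr /(inversion_word hw hr) [w1 [s [w2 [e ->]]]].
move: hw; rewrite e => /gens_word_cat[h1 /gens_word_cons[hs h2]].
exists (w1 ++ w2); split; first exact/gens_word_cat.
  by rewrite !size_cat addnS.
by rewrite !word_prod_cat word_prod_cons !mulgA mulgVK -(mulgA (word_prod w1)) gens_sq // mulg1.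
Qed.

Lemma reduced_inversion_left s w : reduced (s :: w) ->
  inversion (word_prod w) s = false.
Proof.
move=> [/gens_word_cons[hs hw] h]; apply/negbTE/negP.
move=> /(exchange hw (reflection_gens hs)) [v [hv sz e]].
by have := h v hv; rewrite word_prod_cons e => /(_ erefl) /=; rewrite sz => /ltnW; rewrite ltnn.
Qed.

(** A gallery along a reduced word moves away from 1 at every step: otherwise the exchange condition
    would shorten [v ++ s :: w]. *)
Lemma reduced_inversion_right v s w : reduced (v ++ s :: w) ->
  inversion (word_prod v) (word_prod v * s * (word_prod v)^-1) = false.
Proof.
move=> hvw; apply/negbTE/negP => hi.
have [/gens_word_cat[hv /gens_word_cons[hs hw]] h] := hvw.
have [|u [hu sz e]] := exchange hv _ hi; first exact/reflectionJ/reflection_gens.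
have huw : gens_word (u ++ w) by apply/gens_word_cat.
have := h _ huw; rewrite !word_prod_cat word_prod_cons e mulgVK -!mulgA.
move=> /(_ erefl); rewrite !size_cat /= sz addSnnS leq_add2l => /ltnW.
by rewrite ltnn.
Qed.

(** The first letter of a nonempty reduced word of [x] would be an inversion of [x]. *)
Lemma reduced_inversion_eq1 x : (forall r, reflection r -> inversion x r = false) ->
  x = 1.
Proof.
have [[|s w] hw <-] := reduced_exists x; first by rewrite word_prod_nil.
have [/gens_word_cons[hs _] _] := hw; have hr := reflection_gens hs.
move=> /(_ s hr); rewrite word_prod_cons inversion_gensM // eqxx.
by rewrite gens_sq // mul1g (reduced_inversion_left hw).
Qed.

(* Galleries of type [w] from [c] to [z];
   [P c s] allows folding at the panel of type [s] of [c]. *)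
Fixpoint reach (P : A -> A -> Prop) c w z : Prop :=
  if w is s :: w' then reach P (c * s) w' z \/ (P c s /\ reach P c w' z)
  else z = c.

Lemma reach_cat P c v w z :
  reach P c (v ++ w) z <-> exists2 m, reach P c v m & reach P m w z.
Proof.
elim: v c => [|s v IH] c /=; first by split=> [h|[m ->]//]; exists c.
split=> [[/IH[m h1 h2]|[hP /IH[m h1 h2]]]|[m [h1|[hP h1]] h2]].
- by exists m => //; left.
- by exists m => //; right.
- by left; apply/IH; exists m.
- by right; split=> //; apply/IH; exists m.
Qed.

Lemma reachM P Q d c w z : (forall c s, gens s -> P (d * c) s <-> Q c s) ->
  gens_word w -> reach P (d * c) w (d * z) <-> reach Q c w z.
Proof.
move=> h; elim: w c => [|s w IH] c /=; first by move=> _; split=> [/mulgI|->].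
by move=> /gens_word_cons[hs hw]; rewrite -mulgA !IH // h.
Qed.

(** The alcove [c] lies beyond its panel of type [s] as seen from 1. As a predicate for [reach],
    this allows exactly the folds away from 1. *)
Definition descent c s := inversion c (c * s * c^-1).

(* Folding away from 1 on the right commutes with folding away from 1 on the
   left, as in the left and right regular representations of the Hecke algebra. *)
Lemma reach_left t c w z : gens t -> gens_word w ->
  (exists2 m, reach descent c w m & z = t * m \/ (inversion m t /\ z = m)) <->
  (reach descent (t * c) w z \/ (inversion c t /\ reach descent c w z)).
Proof.
move=> ht; elim: w c => [|s w IH] c /=.
  move=> _; split=> [[m -> ]//|[->|[h ->]]]; first by exists c => //; left.
  by exists c => //; right.
move=> /gens_word_cons[hs hw].
have -> : (exists2 m, reach descent (c * s) w m \/
    descent c s /\ reach descent c w m & z = t * m \/ inversion m t /\ z = m) <->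
  ((reach descent (t * (c * s)) w z \/ (inversion (c * s) t /\ reach descent (c * s) w z))
  \/ (descent c s /\
   (reach descent (t * c) w z \/ (inversion c t /\ reach descent c w z)))).
  rewrite -!IH //; split=> [[m [h1|[hd h1]] h2]|[[m h1 h2]|[hd [m h1 h2]]]].
  - by left; exists m.
  - by right; split=> //; exists m.
  - by exists m => //; left.
  - by exists m => //; right.
have hr := reflectionJ c (reflection_gens hs).
(* By [e1] and [e2], multiplying by [t] on the left affects descents on the right, and vice versa,
   only if [t] is the reflection in the panel between [c] and [c * s]. In all other cases the two
   sides agree after reordering. *)
have e1 : descent (t * c) s = (c * s * c^-1 == t) (+) descent c s.
  rewrite /descent inversion_gensM //; last exact/reflectionJ/reflection_gens.
  have -> : t * c * s * (t * c)^-1 = t * (c * s * c^-1) * t.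
    by rewrite invgM (gens_inv ht) !mulgA.
  rewrite -/(descent c s) /descent; move: (c * s * c^-1) => r.
  have K : t * (t * r * t) * t = r.
    by rewrite !mulgA gens_sq // mul1g -(mulgA r) gens_sq // mulg1.
  rewrite K; congr (_ (+) _); apply/eqP/eqP => [e|->]; last by rewrite gens_sq // mul1g.
  by rewrite -K e gens_sq // mul1g.
have e2 : inversion (c * s) t = (c * s * c^-1 == t) (+) inversion c t.
  rewrite inversionM; last exact: reflection_gens.
  rewrite (inversion_gens hs); last by rewrite -[X in _ * X](invgK c); apply/reflectionJ/reflection_gens.
  rewrite addbC; congr (_ (+) _).
  by rewrite eq_sym -(inj_eq (mulgI c)) -(inj_eq (mulIg c^-1)) !mulgA mulgV mul1g mulgK.
rewrite e1 e2 mulgA; have [e|_] /= := eqVneq.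
  (* In the exceptional case left multiplication by [t] and right multiplication by [s] agree at
     [c], and the left and right fold conditions at [c] coincide. *)
  have -> : t * c = c * s by rewrite -e mulgVK.
  have -> : c * s * s = c by rewrite -mulgA gens_sq // mulg1.
  have -> : descent c s = inversion c t by rewrite /descent e.
  by case: (inversion c t) => /=; tauto.
tauto.
Qed.

(** No panel met along a reduced word from 1 is a descent, so no fold is ever allowed. The induction
    needs the part [v] already read. *)
Lemma reach_one_reduced w z : reduced w -> reach descent 1 w z <-> z = word_prod w.
Proof.
suff gen v : reduced (v ++ w) ->
    reach descent (word_prod v) w z <-> z = word_prod (v ++ w).
  by move=> /(gen [::]); rewrite word_prod_nil.
elim: w v => [|s w IH] v hw /=; first by rewrite cats0.
have hw' : reduced (rcons v s ++ w) by rewrite cat_rcons.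
have e : word_prod (rcons v s) = word_prod v * s.
  by rewrite -cats1 word_prod_cat word_prod_cons word_prod_nil mulg1.
have := IH _ hw'; rewrite e cat_rcons => <-.
rewrite /descent (reduced_inversion_right hw); split=> [[//|[]//]|]; by left.
Qed.

(** From the start 1 only the common product is reached. Induction on a reduced word of [e] then
    moves the start to [e]: each new first letter [t] acts on the set of ends in a way that does not
    involve the word read on the right. *)
Lemma reach_descent_indep e w w' z : reduced w -> reduced w' ->
  word_prod w = word_prod w' -> reach descent e w z -> reach descent e w' z.
Proof.
move=> hw hw' ww'; have [v hv <-] := reduced_exists e.
suff: reach descent (word_prod v) w z <-> reach descent (word_prod v) w' z by case.
elim: v hv z => [|t v IH] hv z.
  by rewrite word_prod_nil !reach_one_reduced // ww'.
have [/gens_word_cons[ht _] _] := hv.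
have key u : gens_word u -> reach descent (word_prod (t :: v)) u z <->
    exists2 m, reach descent (word_prod v) u m & z = t * m \/ (inversion m t /\ z = m).
  move=> hu; rewrite reach_left // (reduced_inversion_left hv) word_prod_cons.
  by split=> [|[//|[]//]]; left.
rewrite !key; [|by case: hw'|by case: hw].
have {}IH := IH (@reduced_catr [:: t] v hv).
by split=> -[m h1 h2]; exists m => //; apply/IH.
Qed.

End Folding.

(** * Alcoves cover the space *)

Section Covering.
Context {R : realType} {n : nat} {A : affine_coxeter_system R n}.
Implicit Types (x y z r s t : A) (v w al q : 'rV[R]_n) (c k M : R).

Notation gens := (@gens _ _ A).
Notation act := (@act _ _ A).
Notation reflection := (is_reflection gens).
Notation p0 := (@base_point _ _ A).

(** An injective code with values in a finite type makes [P] finite, so a minimum exists; [h]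
    decodes. *)
Lemma argmin_encoded (T : choiceType) (F : finType) (P : set T) (f : T -> F)
    (g : T -> R) (i0 : T) :
  P i0 -> (forall i j, P i -> P j -> f i = f j -> i = j) ->
  exists2 i, P i & forall j, P j -> g i <= g j.
Proof.
move=> P0 inj; pose B e := `[< exists2 i, P i & f i = e >].
pose h e := xget i0 [set i | P i /\ f i = e].
have hf i : P i -> h (f i) = i.
  move=> Pi; have : [set j | P j /\ f j = f i] (h (f i)) by exact: (@xgetI _ i0 _ i).
  by case=> ? ?; apply: inj.
have B0 : B (f i0) by apply/asboolP; exists i0.
case: (@Order.TotalTheory.arg_minP _ _ _ (f i0) B (fun e => g (h e)) B0) => e.
move=> /asboolP[i Pi <-] m; exists i => // j Pj.
by have := m (f j); rewrite !hf //; apply; apply/asboolP; exists j.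
Qed.

Lemma inversion_segment x r : reflection r -> inversion x r ->
  exists2 k, 0 <= k <= 1 & hyperplane r (p0 + k *: (act x p0 - p0)).
Proof.
move=> hr; have [al [c h]] := reflectionP hr.
rewrite /inversion (side_lt0 _ _ h) (hyperplaneE h) /affine_hyperplane /=.
have [a ea] : exists a, a = dot al p0 by eexists.
have [b eb] : exists b, b = dot al (act x p0) by eexists.
rewrite -ea -eb => ab.
have d0 : a - b != 0.
  by apply/eqP => /eqP; rewrite subr_eq0 => /eqP e; move: ab; rewrite e -expr2 ltNge sqr_ge0.
(* The zero of the affine function [a + k (b - a) - c] of [k], whose values at 0 and 1 have opposite
   signs. *)
exists ((a - c) / (a - b)); last by rewrite !dotE -ea -eb; field.
have [d|d|e] := ltgtP 0 (a - b); last by rewrite -e eqxx in d0.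
  by rewrite ler_pdivrMr // ler_pdivlMr //; apply/andP; split; nra.
by rewrite ler_ndivrMr // ler_ndivlMr //; apply/andP; split; nra.
Qed.

(** The code of [x] records which of the finitely many walls meeting the ball are inversions of [x].
    The ball is convex and contains [p0], so walls missing it separate no orbit point in it from
    [p0], and the inversions determine [x]. *)
Lemma orbit_ball_encoding q M : dot (p0 - q) (p0 - q) <= M ->
  exists (F : finType) (f : A -> F), forall x y,
    dot (act x p0 - q) (act x p0 - q) <= M ->
    dot (act y p0 - q) (act y p0 - q) <= M -> f x = f y -> x = y.
Proof.
move=> p0M; have /finite_seqP[s sE] := @walls_locally_finite _ _ A _ (@ball_compact _ _ q M).
exists ((size s).-tuple bool), (fun x => map_tuple (fun H =>
  `[< exists2 r, reflection r /\ hyperplane r = H & inversion x r >]) (in_tuple s)).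
move=> x y hx hy /(congr1 val) /= e.
have key r : reflection r -> inversion x r = inversion y r.
  move=> hr; have [hs|hs] := boolP (hyperplane r \in s).
    have := congr1 (fun l => nth false l (index (hyperplane r) s)) e.
    rewrite !(nth_map (hyperplane r)) ?index_mem // !nth_index //.
    have E z : `[< exists2 r', reflection r' /\ hyperplane r' = hyperplane r
        & inversion z r' >] = inversion z r.
      apply/asboolP/idP => [[r' [hr' er]]|]; last by exists r.
      by rewrite (@hyperplane_inj _ _ _ r' r) // er.
    by rewrite !E.
  have no z : dot (act z p0 - q) (act z p0 - q) <= M -> inversion z r = false.
    move=> hz; apply/negbTE/negP => /(inversion_segment hr) [k k01 Hk].
    move/negP: hs; apply.
    suff : [set` s] (hyperplane r) by [].
    rewrite -sE; split; first by exists r.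
    exists (p0 + k *: (act z p0 - p0)); split=> //=.
    exact: ball_convex.
  by rewrite !no.
(* By the cocycle rule, equal inversions of [x] and [y] leave none for [x^-1 * y]. *)
have : (x^-1 * y)%g = 1%g.
  apply: reduced_inversion_eq1 => r hr.
  have := key _ (reflectionJ x hr).
  rewrite -{1}(mulVKg x y) inversionM; last exact: reflectionJ.
  rewrite !mulgA mulVg mul1g mulgVK.
  by case: (inversion x _) => /=; case: (inversion _ r).
by move=> /(congr1 (fun z => x * z)%g); rewrite mulVKg mulg1.
Qed.

(* A point of the orbit of [p0] closest to [q] is separated from [q] by no wall:
   reflecting in a separating wall would bring it closer. *)
Lemma covering q : exists x, forall r, reflection r -> 0 <= side r q (act x p0).
Proof.
have [F [f inj]] := orbit_ball_encoding (lexx (dot (p0 - q) (p0 - q))).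
have [|x hx m] := @argmin_encoded _ F
  [set x | dot (act x p0 - q) (act x p0 - q) <= dot (p0 - q) (p0 - q)] f
  (fun x => dot (act x p0 - q) (act x p0 - q)) 1%g _ inj.
  by rewrite /= act_one.
exists x => r hr; rewrite /side subr_ge0 -act_mul.
have sym v w : dot (v - w) (v - w) = dot (w - v) (w - v).
  by rewrite -(opprB w v) dotNl dotNr opprK.
rewrite (sym q) (sym q).
have [h|/ltW] := leP (dot (act (r * x) p0 - q) (act (r * x) p0 - q))
  (dot (p0 - q) (p0 - q)); first exact: m.
exact: le_trans.
Qed.

End Covering.

(** * Translations *)

Section Translations.
Context {R : realType} {n : nat} {A : affine_coxeter_system R n}.
Implicit Types (x y z r s t a b : A) (u v w al q : 'rV[R]_n) (c k M : R).

Notation gens := (@gens _ _ A).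
Notation act := (@act _ _ A).
Notation reflection := (is_reflection gens).
Notation p0 := (@base_point _ _ A).

Lemma translationP t : is_translation t <-> forall v, lin t v = v.
Proof.
split=> [[w h] v|h]; first by rewrite /lin !h add0r addrK.
by exists (act t 0) => v; rewrite act_lin h addrC.
Qed.

Lemma act_translation t v : is_translation t -> act t v = v + act t 0.
Proof. by move=> /translationP h; rewrite act_lin h addrC. Qed.

Lemma translation1 : is_translation (1%g : A).
Proof. by exists 0 => u; rewrite act_one addr0. Qed.

Lemma translationM t t' : is_translation t -> is_translation t' ->
  is_translation (t * t')%g.
Proof. by move=> /translationP h /translationP h'; apply/translationP => v; rewrite linM h' h. Qed.

Lemma translationV t : is_translation t -> is_translation t^-1%g.
Proof. by move=> /translationP h; apply/translationP => v; rewrite -{1}(h v) linK. Qed.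

Lemma lin_reflection r al c v : reflection_data r al c ->
  lin r v = v - (2 * dot al v / dot al al) *: al.
Proof.
case=> al0 h; apply/rowP => i; rewrite /lin !h /orthogonal_reflection dot0r !mxE.
by have /gt_eqF/negbT := dot_gt0 al0 => aP; field.
Qed.

(** Since 0 is special, each wall has a parallel wall through 0; the same normal [al] may be
    kept. *)
Lemma parallel_reflection r al c : reflection r -> reflection_data r al c ->
  exists r0, [/\ reflection r0, reflection_data r0 al 0 & act r0 0 = 0].
Proof.
move=> hr h; have [al0 _] := h.
have [|_ [v [[r0 hr0 ->] H0 E]]] := @origin_special _ _ A (hyperplane r).
  by exists r.
exists r0; have [be [k h0]] := reflectionP hr0; have [be0 e0] := h0.
have k0 : k = 0.
  by move: H0; rewrite -/(hyperplane r0) (hyperplaneE h0) /affine_hyperplane /= dot0r.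
have [l [l0 E1 _]] : exists l, [/\ l != 0, be = l *: al & dot be v = l * c].
  apply: hyperplane_subset_eq => // w; rewrite -(hyperplaneE h) E.
  rewrite -/(hyperplane r0) (hyperplaneE h0) => -[u + <-].
  by rewrite /affine_hyperplane /= dotDr k0 => ->; rewrite add0r.
split=> //; split=> // w; rewrite e0 E1 k0.
by have := orthogonal_reflectionZ 0 l0 al0 w; rewrite mulr0.
Qed.

(** This is [W = T W0]: in a word for [x], each generator is replaced by the reflection in the
    parallel wall through 0, which has the same linear part. *)
Lemma spherical_exists x : exists a, act a 0 = 0 /\ forall v, lin x v = lin a v.
Proof.
move: x; apply: gens_ind => [|s x hs [a [a0 e]]]; first by exists 1%g; rewrite act_one.
have [al [c h]] := reflectionP (reflection_gens hs).
have [r0 [_ h0 r00]] := parallel_reflection (reflection_gens hs) h.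
exists (r0 * a)%g; split=> [|v]; first by rewrite act_mul a0.
by rewrite !linM e (lin_reflection _ h) (lin_reflection _ h0).
Qed.

Lemma translation_divP x a : is_translation (x * a^-1) <-> forall v, lin x v = lin a v.
Proof.
rewrite translationP; split=> h v; first by rewrite -[RHS]h -linM mulgVK.
by rewrite linM h linKV.
Qed.

Lemma spherical_partP x :
  act (spherical_part x) 0 = 0 /\ is_translation (x * (spherical_part x)^-1).
Proof.
have [a [a0 /translation_divP h]] := spherical_exists x.
exact: (@xgetI _ 1%g [set a | act a 0 = 0 /\ is_translation (x * a^-1)] a).
Qed.

Lemma lin_spherical_part x v : lin (spherical_part x) v = lin x v.
Proof. by have [_ /translation_divP ->] := spherical_partP x. Qed.

Lemma lin_inj a b : act a 0 = 0 -> act b 0 = 0 -> (forall v, lin a v = lin b v) -> a = b.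
Proof.
move=> a0 b0 h; apply: (@act_faithful _ _ A) => v.
by rewrite (act_lin a) (act_lin b) a0 b0 h.
Qed.

Lemma spherical_part_unique x a : act a 0 = 0 -> (forall v, lin x v = lin a v) ->
  spherical_part x = a.
Proof.
move=> a0 h; apply: lin_inj => //; first by have [] := spherical_partP x.
by move=> v; rewrite lin_spherical_part h.
Qed.

Lemma spherical_partM x y :
  spherical_part (x * y)%g = (spherical_part x * spherical_part y)%g.
Proof.
apply: spherical_part_unique => [|v]; last by rewrite !linM !lin_spherical_part.
by rewrite act_mul; have [-> _] := spherical_partP y; have [-> _] := spherical_partP x.
Qed.

(** The point [q] itself may lie on the wall, hence the strict bound [k < 1]. *)
Lemma base_alcove_path q r k : reflection r -> 0 <= side r q p0 -> 0 <= k -> k < 1 ->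
  ~ hyperplane r (p0 + k *: (q - p0)).
Proof.
move=> hr; have [al [c h]] := reflectionP hr.
rewrite leNgt (side_lt0 _ _ h) -leNgt (hyperplaneE h) /affine_hyperplane /=.
have := base_point_off 1%g hr h; rewrite act_one !dotE.
move: (dot al p0) (dot al q) => a b ac hab k0 k1 e.
have E : (1 - k) * (a - c) = - (k * (b - c)) by lra.
have : 0 < (1 - k) * (a - c) ^+ 2 by rewrite mulr_gt0 ?subr_gt0 // exprn_even_gt0.
by rewrite expr2 mulrA E mulNr -mulrA oppr_gt0 ltNge mulr_ge0.
Qed.

(** The segment from [p0] to its midpoint with [q] meets no wall, so the midpoint lies in the open
    base alcove, which is bounded. *)
Lemma unseparated_bounded : exists M, forall q,
  (forall r, reflection r -> 0 <= side r q p0) -> dot q q <= M.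
Proof.
have [B hB] := bounded_set_dot (@base_alcove_bounded _ _ A).
(* If [m] is the midpoint, then [q = 2 m - p0], whose square is at most
   [2 * 4 * B + 2 * dot p0 p0]. *)
exists (8 * B + 2 * dot p0 p0) => q hq.
have [p pC E] := base_alcove_component A.
have E' : base_alcove A = connected_component (complement (walls gens act)) p0.
  by rewrite E; apply: same_connected_component; rewrite -E; exact: base_pointP.
have : base_alcove A (p0 + 2^-1 *: (q - p0)).
  rewrite E'.
  apply: (@connected_component_max _ _ ((fun k => p0 + k *: (q - p0)) @` `[0, 2^-1])).
  - exists 0; last by rewrite scale0r addr0.
    by rewrite /= in_itv /=; lra.
  - move=> _ [k /= + <-] [_ [r hr ->]]; rewrite in_itv /= => /andP[k0 k1].
    by apply: (base_alcove_path hr (hq r hr) k0); lra.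
  - exact: affine_path_connected.
  - by exists 2^-1 => //; rewrite /= in_itv /=; lra.
move=> /hB; have := dot_sqD_le (2 *: (p0 + 2^-1 *: (q - p0))) (- p0).
have -> : 2 *: (p0 + 2^-1 *: (q - p0)) + - p0 = q.
  by apply/rowP => i; rewrite !mxE; field.
move: (p0 + _) => m; rewrite !dotE; lra.
Qed.

(* Otherwise the orbit of the base alcove would stay in a slab around the
   hyperplane, whereas by [covering] it comes close to every point. *)
Lemma translation_exists r al c : reflection r -> reflection_data r al c ->
  exists2 t, is_translation t & dot al (act t 0) != 0.
Proof.
move=> hr h; have [//|nex] := pselect (exists2 t, is_translation t & dot al (act t 0) != 0).
have H t : is_translation t -> dot al (act t 0) = 0.
  by move=> ht; apply/eqP; have [//|e] := boolP (_ == 0); case: nex; exists t.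
exfalso.
have [M hM] := unseparated_bounded.
have [/dot_gt0 al0 _] := h.
(* The height of [k *: al] becomes [dot al al + |M| + 1], more than a vector of squared length at
   most [M] can have along [al]. *)
pose k := (dot al al + `|M| + 1) / dot al al.
have [x hx] := @covering _ _ A (k *: al).
pose q := act x^-1%g (k *: al).
have qM : dot q q <= M.
  by apply: hM => r' hr'; rewrite -(sideJ x) /q actKV; apply: hx; exact: reflectionJ.
have x0 : dot al (act x 0) = 0.
  have [s0 hs] := spherical_partP x.
  by rewrite -(mulgVK (spherical_part x) x) act_mul s0; apply: H.
have : dot al (k *: al) = dot al (lin x q).
  by rewrite -[in LHS](actKV x (k *: al)) -/q act_lin dotDr x0 add0r.
rewrite dotZr /k divfK ?gt_eqF // => e.
have := dot_le al (lin x q); rewrite dot_lin -e; have := ler_norm M.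
by have := normr_ge0 M; lra.
Qed.

(** Powers of a translation not parallel to the wall, inverted if necessary to make its height
    positive. *)
Lemma translation_far r al c M : reflection r -> reflection_data r al c ->
  exists2 t, is_translation t & M <= dot al (act t 0).
Proof.
move=> hr h.
have [t ht tP] : exists2 t, is_translation t & 0 < dot al (act t 0).
  have [t ht t0] := translation_exists hr h.
  have [lt|gt|/esym/eqP] := ltgtP 0 (dot al (act t 0)); first by exists t.
    exists t^-1%g; first exact: translationV.
    have := actK t 0; rewrite (act_translation _ (translationV ht)) => /eqP.
    by rewrite addr_eq0 => /eqP e; rewrite -oppr_lt0 -dotNr -e.
  by rewrite (negbTE t0).
have pw m : exists2 t', is_translation t' & dot al (act t' 0) = m%:R * dot al (act t 0).
  elim: m => [|m [t' ht' e]].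
    by exists 1%g; [exact: translation1 | rewrite act_one dot0r mul0r].
  exists (t * t')%g; first exact: translationM.
  by rewrite act_mul (act_translation _ ht) dotDr e -natr1 mulrDl mul1r.
have [t' ht' e] := pw (Num.bound `|M / dot al (act t 0)|); exists t' => //.
rewrite e -ler_pdivrMr //; apply: le_trans (ler_norm _) _.
by apply/ltW/archi_boundP; exact: normr_ge0.
Qed.

End Translations.

(** * Directions *)

Section Directions.
Context {R : realType} {n : nat} {A : affine_coxeter_system R n}.
Implicit Types (x y z r s t a b d : A) (u v w al q : 'rV[R]_n) (c k M : R).
Implicit Types (phi : set (set 'rV[R]_n)) (B C D P : set 'rV[R]_n).

Notation gens := (@gens _ _ A).
Notation act := (@act _ _ A).
Notation reflection := (is_reflection gens).
Notation p0 := (@base_point _ _ A).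

Lemma translateK v : cancel (@translate R n v) (translate (- v)).
Proof.
move=> D; apply/seteqP; split=> [_ [_ [u Du <-] <-]|u Du]; first by rewrite addrK.
by exists (u + v); [exists u | rewrite addrK].
Qed.

Lemma translateS v B C : B `<=` C -> translate v B `<=` translate v C.
Proof. by move=> BC _ [u /BC Cu <-]; exists u. Qed.

Lemma translation_continuous v : continuous (fun u : 'rV[R]_n => u + v).
Proof.
move=> u.
exact: (@cvgD _ _ _ (nbhs u) (nbhs_filter u) id (fun=> v) u v cvg_id (cvg_cst _)).
Qed.

Lemma closure_translate v C : closure (translate v C) = translate v (closure C).
Proof.
have sub w B : translate w (closure B) `<=` closure (translate w B).
  move=> _ [u Bu <-] N /(@translation_continuous w u) /Bu [u' [Bu' Nu']].
  by exists (u' + w); split=> //; exists u'.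
apply/seteqP; split; last exact: sub.
rewrite -[X in X `<=` _](translateK (- v)) opprK; apply: translateS.
by have := sub (- v) (translate v C); rewrite translateK.
Qed.

Lemma component_translate v B q :
  connected_component (translate v B) (q + v) = translate v (connected_component B q).
Proof.
have sub w E p : translate w (connected_component E p) `<=`
    connected_component (translate w E) (p + w).
  move=> _ [u [E' [E'p E'E cE'] E'u] <-].
  exists (translate w E'); last by exists u.
  split; [by exists p | exact: translateS |].
  apply: connected_continuous_connected => //.
  by apply/continuous_subspaceT/translation_continuous.
apply/seteqP; split; last exact: sub.
rewrite -[X in X `<=` _](translateK (- v)) opprK; apply: translateS.
by have := sub (- v) (translate v B) (q + v); rewrite translateK addrK.
Qed.

Lemma complement_walls_through x v w : complement (walls_through A v) w ->
  complement (walls_through A (act x v)) (act x w).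
Proof.
move=> h [_ [[r hr ->] Hv] Hw]; apply: h.
have E u : hyperplane r (act x u) -> hyperplane (x^-1 * r * x^-1^-1) u.
  by move=> Hu; rewrite -[u](actK x); apply/hyperplaneJ.
exists (hyperplane (x^-1 * r * x^-1^-1)); last exact: E.
split; last exact: E.
by exists (x^-1 * r * x^-1^-1)%g => //; exact: reflectionJ.
Qed.

Lemma weyl_chamber_translate t D : is_translation t -> weyl_chamber A D ->
  weyl_chamber A (translate (act t 0) D).
Proof.
move=> ht [t1 [ht1 [C [q qF ->] ->]]].
exists (t * t1)%g; split; first exact: translationM.
exists (translate (act t 0) (connected_component (complement (walls_through A (act t1 0))) q));
  last by rewrite closure_translate.
rewrite act_mul -component_translate; exists (q + act t 0).
  by rewrite -(act_translation _ ht); exact: complement_walls_through.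
congr (connected_component _ _); apply/seteqP; split=> [_ [u hu <-]|u hu].
  by rewrite -(act_translation _ ht); exact: complement_walls_through.
exists (act t^-1%g u); last by rewrite -(act_translation _ ht) actKV.
by have := @complement_walls_through t^-1%g _ _ hu; rewrite actK.
Qed.

Lemma direction_translate phi D t : is_direction A phi -> is_translation t ->
  phi D -> phi (translate (act t 0) D).
Proof.
move=> [D0 _ ->] ht [hD [v e]]; split; first exact: weyl_chamber_translate.
rewrite e; exists (v + act t 0); apply/seteqP; split=> [_ [_ [u Du <-] <-]|_ [u Du <-]].
  by exists u => //; rewrite addrA.
by exists (u + v); [exists u | rewrite addrA].
Qed.

Lemma alcove_side x r al c v : reflection r -> reflection_data r al c ->
  c < dot al (act x p0) -> base_alcove A v -> c < dot al (act x v).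
Proof.
move=> hr h; have h' := reflection_dataJ x^-1%g h.
have E w : dot (lin x^-1 al) w = dot al (act x w) + dot (lin x^-1 al) (act x^-1%g 0).
  by rewrite -{1}(actK x w) dot_act.
move=> cp Cv; rewrite -(ltrD2r (dot (lin x^-1 al) (act x^-1%g 0))) -E.
by apply: (base_alcove_side (reflectionJ _ hr) h') => //; rewrite (E p0) ltrD2r.
Qed.

Lemma half_spaceJ x r P : half_space (hyperplane r) P ->
  half_space (hyperplane (x * r * x^-1)) (act x @` P).
Proof.
move=> [al [c [al0 E ->]]].
have e v : dot (lin x al) v = dot al (act x^-1%g v) + dot (lin x al) (act x 0).
  by rewrite -{1}(actKV x v) dot_act.
exists (lin x al), (c + dot (lin x al) (act x 0)); split; first exact: lin_neq0.
  apply/seteqP; split=> v.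
    rewrite -{1}(actKV x v) => /hyperplaneJ; rewrite E /affine_hyperplane /= e.
    by move=> ->.
  rewrite /affine_hyperplane /= e => /addIr h; rewrite -(actKV x v).
  by apply/hyperplaneJ; rewrite E.
apply/seteqP; split=> [_ [v /= cv <-]|v /=]; first by rewrite (e (act x v)) actK lerD2r.
by rewrite (e v) lerD2r => h; exists (act x^-1%g v) => //; rewrite actKV.
Qed.

Lemma alcoveM x y : alcove (x * y) = act x @` alcove y.
Proof.
apply/seteqP; split=> [_ [v Cv <-]|_ [_ [v Cv <-] <-]].
  by exists (act y v); [exists v | rewrite act_mul].
by exists v => //; rewrite act_mul.
Qed.

(** Transport by [x]: it differs from its spherical part [b] by a translation, and translating a
    chamber by an element of [T] keeps it in [phi]. *)
Lemma on_positive_sideJ phi x y r : is_direction A phi ->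
  on_positive_side (dir_act (spherical_part x)^-1 phi) (hyperplane r) y <->
  on_positive_side phi (hyperplane (x * r * x^-1)) (x * y)%g.
Proof.
move=> hphi; have [b0 ht] := spherical_partP x; set b := spherical_part x in b0 ht *.
split=> [[P [hP [_ [D phiD <-] DP]] aP]|[P [hP [D phiD DP]] aP]].
  exists (act x @` P); last by rewrite alcoveM; exact: image_subset.
  split; first exact: half_spaceJ.
  exists (translate (act (x * b^-1)%g 0) D); first exact: direction_translate.
  move=> _ [v Dv <-]; exists (act b^-1%g v); first by apply: DP; exists v.
  by rewrite -act_mul act_translation.
exists (act x^-1%g @` P); last first.
  by rewrite -[y](mulKg x) alcoveM; exact: image_subset.
split.
  by have := half_spaceJ x^-1%g hP; rewrite invgK !mulgA mulVg mul1g mulgVK.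
have ht' := translationV ht.
exists [set act b^-1%g v | v in translate (act (x * b^-1)^-1%g 0) D].
  by exists (translate (act (x * b^-1)^-1%g 0) D) => //; exact: direction_translate.
move=> _ [_ [v Dv <-] <-]; exists v; first exact: DP.
by rewrite -act_translation // -act_mul invgM invgK mulKg.
Qed.

(** The vector [u] points from the vertex [o] of a chamber representing [phi] to an interior point
    [q]. The positive side of a wall is the one towards which [u] points. *)
Lemma direction_vector phi : is_direction A phi -> exists u,
  forall r al c, reflection r -> reflection_data r al c ->
    dot al u != 0 /\ (0 < dot al u -> forall x,
      on_positive_side phi (hyperplane r) x <-> c < dot al (act x p0)).
Proof.
move=> hphi; have [D [t [ht [C [q qF CE] DE]]] phiE] := hphi.
pose o := act t 0; exists (q - o) => r al c hr h.
have [al0 _] := h.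
(* Like 0, its translate [o] lies on a wall parallel to any given wall. *)
have wall_o be k r' : reflection r' -> reflection_data r' be k ->
    walls_through A o (affine_hyperplane be (dot be o)).
  move=> hr' h'; have [r0 [hr0 h0 _]] := parallel_reflection hr' h'.
  have := reflection_dataJ t h0; rewrite add0r (proj1 (translationP t) ht) => ht0.
  split=> //; rewrite -(hyperplaneE ht0).
  by exists (t * r0 * t^-1)%g => //; exact: reflectionJ.
have offC v : complement (walls_through A o) v -> dot al v != dot al o.
  move=> hv; apply/eqP => e; apply: hv.
  by exists (affine_hyperplane al (dot al o)); first exact: wall_o h.
have Csub v : C v -> complement (walls_through A o) v.
  by rewrite CE => /connected_component_sub.
have Cq : C q by rewrite CE; apply: connected_component_refl.
rewrite dotDr dotNr subr_eq0; split; first exact: offC.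
rewrite subr_gt0 => oq x.
have Dside v : D v -> dot al o <= dot al v.
  rewrite DE => Dv; suff: closure [set w | dot al o <= dot al w] v by move/closed_half_space.
  apply: closureS Dv => w Cw; apply/ltW.
  apply: (@connected_dot_side _ _ C al (dot al o)) Cq Cw oq.
    by rewrite CE; exact: component_connected.
  by move=> v' /Csub/offC/eqP.
(* The ray from [q] away from [o] crosses no wall through [o], so the chamber is unbounded in the
   direction [u]. *)
have Dray k : 1 <= k -> D (o + k *: (q - o)).
  move=> k1; rewrite DE; apply: subset_closure; rewrite CE.
  apply: (@connected_component_max _ _ ((fun k' => o + k' *: (q - o)) @` `[1, k])).
  - exists 1; last by rewrite scale1r addrC subrK.
    by rewrite /= in_itv /= lexx.
  - move=> _ [k' /= + <-] [_ [[r' hr' ->] Ho] Hv]; rewrite in_itv /= => /andP[k'1 _].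
    have [be [m h']] := reflectionP hr'.
    move: Ho Hv; rewrite -/(hyperplane r') (hyperplaneE h') /affine_hyperplane /=.
    move=> Ho; rewrite !dotE -/o Ho => e.
    have [e'|] := eqVneq (dot be q) (dot be o).
      by apply: (Csub q Cq); exists (affine_hyperplane be (dot be o)); first exact: wall_o h'.
    rewrite Ho => /eqP; apply.
    have /eqP : k' * (dot be q - m) = 0 by lra.
    by rewrite mulf_eq0 (gt_eqF (lt_le_trans ltr01 k'1)) subr_eq0 => /eqP.
  - exact: affine_path_connected.
  - by exists k => //; rewrite /= in_itv /= k1 lexx.
have xoff := base_point_off x hr h.
split=> [[P [[be [m [be0 HE PE]]] [D' phiD' D'P]] aP]|cx].
  have [l [l0 bE mE]] : exists l, [/\ l != 0, be = l *: al & m = l * c].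
    by apply: hyperplane_subset_eq => //; rewrite -HE (hyperplaneE h).
  move: phiD'; rewrite phiE => -[_ [v vD']].
  have inP k : 1 <= k -> l * c <= l * (dot al o + dot al v + k * (dot al q - dot al o)).
    move=> k1; have : P (o + k *: (q - o) + v).
      by apply: D'P; rewrite vD'; exists (o + k *: (q - o)) => //; exact: Dray.
    rewrite PE /= bE mE dotZl !dotE; congr (_ <= l * _); ring.
  have lP : 0 < l.
    rewrite lt_neqAle eq_sym l0 leNgt /=; apply/negP => lN.
    have qo : 0 < dot al q - dot al o by rewrite subr_gt0.
    pose e := c - (dot al o + dot al v).
    (* For negative [l], the ray has left the half-space at this parameter. *)
    have := inP (1 + `|e| / (dot al q - dot al o)).
    rewrite lerDl divr_ge0 ?(ltW qo) // => /(_ isT); rewrite ler_nM2l //.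
    rewrite mulrDl divfK ?gt_eqF // mul1r.
    by have := ler_norm e; rewrite /e; lra.
  have : P (act x p0) by apply: aP; exists p0 => //; exact: base_pointP.
  rewrite PE /= bE mE dotZl ler_pM2l // le_eqVlt => /orP[/eqP e|//].
  by move: xoff; rewrite e subrr eqxx.
exists [set v | c <= dot al v]; last first.
  by move=> _ [v Cv <-] /=; apply/ltW/(alcove_side hr h).
split; first by exists al, c; rewrite (hyperplaneE h).
(* Conversely, the chamber is translated so far that its vertex, and with it the whole chamber, lies
   on the required side. *)
have [t' ht' far] := translation_far (c - dot al o) hr h.
exists (translate (act t' 0) D).
  rewrite phiE; split; last by exists (act t' 0).
  by apply: weyl_chamber_translate => //; exists t; split=> //; exists C => //; exists q.
by move=> _ [v /Dside hv <-] /=; rewrite dotDr; lra.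
Qed.

(* A single alcove deep on the negative side of finitely many walls turns
   folding towards [phi] into folding away from that alcove. *)
Lemma negative_alcove phi (l : seq A) : is_direction A phi ->
  (forall r, r \in l -> reflection r) ->
  exists d, forall r x, r \in l ->
    on_positive_side phi (hyperplane r) x <-> side r (act x p0) (act d p0) < 0.
Proof.
move=> /direction_vector[u hu] hl.
have pos r : reflection r -> exists al c, reflection_data r al c /\ 0 < dot al u.
  move=> hr; have [al [c h]] := reflectionP hr; have [au _] := hu _ _ _ hr h.
  have r0 : ~ hyperplane r (u + (c / dot al al) *: al).
    rewrite (hyperplaneE h) /affine_hyperplane /= dotDr hyperplane_point; last by case: h.
    by move/eqP; rewrite addrC -subr_eq0 addrAC subrr add0r (negbTE au).
  have [be [k [h' kb]]] := reflectionP_pos hr r0.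
  exists be, k; split=> //.
  have [al0 _] := h; have [be0 _] := h'.
  have : affine_hyperplane be k (((c / dot al al) *: al)).
    by rewrite -(hyperplaneE h') (hyperplaneE h) /affine_hyperplane /= hyperplane_point.
  by rewrite /affine_hyperplane /= => e; move: kb; rewrite dotDr e -ltrBlDr subrr.
have [M hM] : exists M, forall k, M <= k -> forall r, r \in l ->
    exists al c, [/\ reflection_data r al c, 0 < dot al u & dot al (- (k *: u)) < c].
  elim: l hl => [|r l IH] hl; first by exists 0.
  have [|M hM] := IH; first by move=> r' r'l; apply: hl; rewrite in_cons r'l orbT.
  have [al [c [h au]]] := pos r (hl r (mem_head _ _)).
  (* Beyond this bound the height of [- (k *: u)] is at most [c - 1]; the 1 makes the inequality
     strict. *)
  exists (Num.max M ((1 - c) / dot al u)) => k; rewrite ge_max => /andP[Mk ck] r'.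
  rewrite in_cons => /orP[/eqP->|]; last exact: hM.
  exists al, c; split=> //; move: ck; rewrite ler_pdivrMr // !dotE; lra.
have [d hd] := @covering _ _ A (- (M *: u)).
exists d => r x rl; have hr := hl _ rl.
have [al [c [h au qc]]] := hM M (lexx M) r rl.
have [_ /(_ au x) ->] := hu _ _ _ hr h.
rewrite (side_lt0 _ _ h).
have dc : dot al (act d p0) - c < 0.
  rewrite lt_neqAle (base_point_off d hr h) /=.
  have := hd r hr; rewrite leNgt (side_lt0 _ _ h) -leNgt nmulr_rge0 //.
  by rewrite subr_lt0.
by rewrite nmulr_llt0 // subr_gt0.
Qed.

End Directions.

(** * Shadows *)

Section Galleries.
Context {R : realType} {n : nat} {A : affine_coxeter_system R n}.
Implicit Types (x y z r s t c d : A) (w v : seq A).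
Implicit Types (phi : set (set 'rV[R]_n)).

Notation gens := (@gens _ _ A).
Notation act := (@act _ _ A).
Notation reflection := (is_reflection gens).
Notation p0 := (@base_point _ _ A).
Local Open Scope group_scope.

Definition foldable phi c s := on_positive_side phi (hyperplane (c * s * c^-1)) c.

Lemma panel_neq c s : gens s -> c <> c * s.
Proof. by move=> hs e; apply: (gens_neq1 hs); apply: (mulgI c); rewrite mulg1 -e. Qed.

(** The wall of a panel does not depend on the coset representative, which the definition of
    [panel_hyperplane] leaves open. *)
Lemma panel_reflection c s x s' : gens s -> gens s' ->
  [set c; c * s] = [set x; x * s'] -> c * s * c^-1 = x * s' * x^-1.
Proof.
move=> hs hs' E.
have ne' := @panel_neq x s' hs'.
have : [set c; c * s] x by rewrite E; left.
have : [set c; c * s] (x * s') by rewrite E; right.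
move=> [e1|e1] [e2|e2].
- by case: ne'; rewrite e1.
- by rewrite e1 e2 invgM (gens_inv hs) mulgA.
- by rewrite e1 e2.
- by case: ne'; rewrite e1.
Qed.

(** Once the type is prescribed, a gallery only chooses, letter by letter, between crossing the
    panel and staying. *)
Lemma gallery_reach phi c w z : gens_word w ->
  (exists g, [/\ is_gallery c g, gallery_type g w, gallery_end c g = z
    & positively_folded phi c g]) <-> reach (foldable phi) c w z.
Proof.
elim: w c => [|s w IH] c.
  move=> _; split=> [[[|[p e] g] [//= _ _ <- //]]|/= ->].
  by exists [::].
move=> /gens_word_cons[hs hw]; split=> [[[|[p e] g] []//=]|/=].
  move=> [_ pc pe gg] [[_ [x pE]] gt] ge [fold gf].
  have IH' : reach (foldable phi) e w z by apply/IH => //; exists g.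
  have {pE} pE : p = [set c; c * s].
    move: pc; rewrite pE => -[->//|->]; rewrite -mulgA gens_sq // mulg1.
    by apply/seteqP; split=> y [->|->]; [right|left|right|left].
  have [ce|ce] : e = c \/ e = c * s by move: pe; rewrite pE.
    rewrite ce in fold IH'; right; split=> //.
    by apply: (fold erefl); exists c, s.
  by left; rewrite -ce.
have hp : panel_of_type [set c; c * s] s by split=> //; exists c.
move=> [/IH-/(_ hw)|[hf /IH-/(_ hw)]] [g [gg gt ge gf]].
  exists (([set c; c * s], c * s) :: g); split=> //=.
    by split=> //; [exists s | left | right].
  by split=> // /(panel_neq hs).
exists (([set c; c * s], c) :: g); split=> //=.
  by split=> //; [exists s | left | left].
split=> // _ H [x [s' [hs' E ->]]].
by rewrite -(panel_reflection hs hs' E).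
Qed.

Lemma shadowP phi x z : shadow phi x z <->
  exists w, [/\ reduced w, word_prod w = x & reach (foldable phi) 1 w z].
Proof.
split=> [[w [g [/reduced_wordE[hw e] gg gt ge gf]]]|[w [hw e hr]]].
  by exists w; split=> //; apply/gallery_reach; [case: hw | exists g].
have [hg _] := hw.
have [g [gg gt ge gf]] := proj2 (gallery_reach phi 1 z hg) hr.
by exists w, g; split=> //; apply/reduced_wordE.
Qed.

(** Both branches are followed at every letter, whether or not the fold is allowed. The list is
    therefore finite and valid for every fold condition. *)
Fixpoint visited c w : seq A :=
  if w is s :: w' then (c * s * c^-1) :: visited (c * s) w' ++ visited c w' else [::].

Lemma visited_reflection c w r : gens_word w -> r \in visited c w -> reflection r.
Proof.
elim: w c => [//|s w IH] c /gens_word_cons[hs hw] /=.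
rewrite in_cons mem_cat => /orP[/eqP->|/orP[]]; try exact: IH.
exact/reflectionJ/reflection_gens.
Qed.

Lemma eq_reach (P Q : A -> A -> Prop) c w z :
  (forall c' s, c' * s * c'^-1 \in visited c w -> P c' s <-> Q c' s) ->
  reach P c w z <-> reach Q c w z.
Proof.
elim: w c => [|s w IH] c //= h.
have hv c' s' : c' * s' * c'^-1 \in visited (c * s) w ++ visited c w -> P c' s' <-> Q c' s'.
  by move=> hin; apply: h; rewrite in_cons hin orbT.
rewrite IH; last by move=> *; apply: hv; rewrite mem_cat; apply/orP; left.
rewrite IH; last by move=> *; apply: hv; rewrite mem_cat; apply/orP; right.
by rewrite h // in_cons eqxx.
Qed.

Lemma side_sym r (u v : 'rV[R]_n) : reflection r -> side r u v = side r v u.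
Proof. by move=> /reflectionP[al [k h]]; rewrite !(sideE _ _ h) (mulrC (dot al u - k)%R). Qed.

Lemma reach_foldable_indep phi w w' z : is_direction A phi ->
  reduced w -> reduced w' -> word_prod w = word_prod w' ->
  reach (foldable phi) 1 w z -> reach (foldable phi) 1 w' z.
Proof.
move=> hphi hw hw' ww'; have [hg _] := hw; have [hg' _] := hw'.
have [|d hd] := negative_alcove (l := visited 1 w ++ visited 1 w') hphi.
  by move=> r; rewrite mem_cat => /orP[] /visited_reflection; apply.
pose Q c s := (side (c * s * c^-1) (act c p0) (act d p0) < 0)%R.
(* Left multiplication by [d^-1] moves [d] to 1 and the start 1 to [d^-1]. *)
have Qd v : gens_word v -> reach Q 1 v z <-> reach descent d^-1 v (d^-1 * z).
  rewrite -{1}(mulgV d) -{1}(mulVKg d z) => hv; apply: reachM => // c s hs.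
  rewrite /Q /descent /inversion.
  have -> : d * c * s * (d * c)^-1 = d * (c * s * c^-1) * d^-1.
    by rewrite invgM !mulgA.
  by rewrite act_mul sideJ side_sym //; apply/reflectionJ/reflection_gens.
have sub v : {subset visited 1 v <= visited 1 w ++ visited 1 w'} -> gens_word v ->
    reach (foldable phi) 1 v z <-> reach descent d^-1 v (d^-1 * z).
  move=> hv hgv; rewrite -Qd //; apply: eq_reach => c s /hv; exact: hd.
rewrite !sub //; first exact: reach_descent_indep.
  by move=> r hr /=; rewrite mem_cat hr orbT.
by move=> r hr /=; rewrite mem_cat hr.
Qed.

Lemma len_reduced w : reduced w -> len (word_prod w) = size w.
Proof.
move=> hw; rewrite /len /length; case: xgetP => [k _ [v]|/(_ (size w)) []].
  move=> /reduced_wordE[[hv mv] e] <-; have [hg mw] := hw.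
  by apply/eqP; rewrite eqn_leq mv ?mw.
by exists w => //; apply/reduced_wordE.
Qed.

Lemma reduced_cat v w : reduced v -> reduced w ->
  len (word_prod v * word_prod w) = (len (word_prod v) + len (word_prod w))%N ->
  reduced (v ++ w).
Proof.
move=> hv hw e; split; first by apply/gens_word_cat; split; [case: hv | case: hw].
move=> u hu; rewrite word_prod_cat => ue.
have [u' hu' u'e] := reduced_exists (word_prod v * word_prod w).
rewrite size_cat -(len_reduced hv) -(len_reduced hw) -e -u'e (len_reduced hu').
by have [_] := hu'; apply=> //; rewrite ue u'e.
Qed.

(** A gallery starting at [x] is moved back to 1, which replaces the direction [phi] by its image
    under the inverse spherical part of [x]. *)
Lemma reach_foldable_shift phi x w z : is_direction A phi -> gens_word w ->
  reach (foldable phi) x w (x * z) <->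
  reach (foldable (dir_act (spherical_part x)^-1 phi)) 1 w z.
Proof.
move=> hphi hw; rewrite -{1}(mulg1 x); apply: reachM => // c s hs.
rewrite /foldable on_positive_sideJ //.
by rewrite invgM !mulgA.
Qed.

End Galleries.

(** * Shadows of length-additive products *)

Local Open Scope classical_set_scope.
Local Open Scope group_scope.

Theorem theorem7p3 (R : realType) (n : nat) (A : affine_coxeter_system R n)
  (x y a : A) (phi : set (set 'rV[R]_n)) :
  len (x * y) = (len x + len y)%N ->
  W0 A a ->
  is_direction A phi ->
  partial_shadow phi a (x * y) =
    \bigcup_(b in W0 A)
      set_mul (partial_shadow phi b x)
              (partial_shadow (dir_act b^-1 phi) (b^-1 * a) y).
Proof.
move=> hlen _ hphi; apply/seteqP; split=> [z [/shadowP[w [hw wE hz]] <-]|].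
  have [v hv vE] := reduced_exists x; have [u hu uE] := reduced_exists y.
  have hvu : reduced (v ++ u) by apply: reduced_cat => //; rewrite vE uE.
  (* The reduced word [w] of [x * y] is exchanged for [v ++ u]; the gallery is then cut at the
     alcove [m] reached after [v]. *)
  have [m hm hmz] : exists2 m, reach (foldable phi) 1 v m & reach (foldable phi) m u z.
    apply/reach_cat; apply: reach_foldable_indep hz => //.
    by rewrite word_prod_cat vE uE.
  exists (spherical_part m); first by have [] := spherical_partP m.
  exists m; first by split=> //; apply/shadowP; exists v.
  exists (m^-1 * z); last by rewrite mulVKg.
  split.
    apply/shadowP; exists u; split=> //; have [hg _] := hu.
    by apply/reach_foldable_shift => //; rewrite mulVKg.
  by rewrite -[in RHS](mulVKg m z) spherical_partM mulKg.
move=> _ [b _ [m [/shadowP[v [hv vE hm]] mb] [k [/shadowP[u [hu uE hk]] kb] <-]]].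
have hvu : reduced (v ++ u) by apply: reduced_cat => //; rewrite vE uE.
(* Conversely, the gallery ending at [k] is moved by [m] and appended to the one ending at [m]; the
   spherical parts multiply to [b * (b^-1 * a) = a]. *)
split; last by rewrite spherical_partM mb kb mulVKg.
apply/shadowP; exists (v ++ u); split=> //; first by rewrite word_prod_cat vE uE.
apply/reach_cat; exists m => //; have [hg _] := hu.
by apply/reach_foldable_shift => //; rewrite mb.
Qed.
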